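(* Let $X$ be a set, and let $F$, $N$, $N'$, the wire $F/N'$, the polynomials $f_u$ and the wire $\mathcal{W}(X)$ be as defined in the context. The wire morphism $$\mathfrak{d}\colon F/N'\to\mathcal{W}(X),\qquad [u]\mapsto f_u$$ is an isomorphism (i.e. a bijective wire morphism).
   Context: A wire is a triple $(W,\star,\circ)$ with $(W,\star)$ a group, $(W,\circ)$ a semigroup, and $a\circ(b\star c)=(a\circ b)\star a^{-1}\star(a\circ c)$, $(b\star c)\circ a=(b\circ a)\star a^{-1}\star(c\circ a)$ for all $a,b,c\in W$, where $a^{-1}$ is the inverse with respect to $\star$. It is commutative if $\circ$ is commutative. A wire morphism is a map preserving $\star$ and $\circ$. The wire $F/N'$. Let $Y=M_{\mathrm c}(X)$ be the free commutative semigroup (without identity) generated by $X$, with operation $\circ$. Let $F=P_{\mathrm c}(X)$ be the free group generated by the set $Y$, with operation $\star$ and neutral element $e$. Write elements of $F$ as $u=\prod_{i=1}^n u_i^{\epsilon_i}=u_1^{\epsilon_1}\star\cdots\star u_n^{\epsilon_n}$ with $u_i\in Y$, $\epsilon_i\in\{1,-1\}$ (ordered product, not necessarily reduced). For $l\in Y$ put $u\circ l=\left(\prod_{i=1}^n((u_i\circ l)\star l^{-1})^{\epsilon_i}\right)\star l$. For $v=\prod_{j=1}^m v_j^{\delta_j}\in F$ put $u\circ_l v=u\star\prod_{j=1}^m\left(u^{-1}\star(u\circ v_j)\right)^{\delta_j}$. These do not depend on the chosen word representatives. Let $N$ be the normal subgroup of $F$ generated by the elements $m^{-1}\star(m\circ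 l)\star l^{-1}$ for $m,l\in Y$, and $N'=[N,N]$. Then $\star$ and $[u]\circ[v]=[u\circ_l v]$ make $F/N'$ a commutative wire. The group $F/N$ is the free commutative group generated by (the images of) $X$. Fox derivatives. For $u=\prod_{i=1}^n u_i^{\epsilon_i}\in F$ and $1\le k\le n$ let $u_{(k)}=\prod_{i=1}^{k-1}u_i^{\epsilon_i}$ if $\epsilon_k=1$ and $u_{(k)}=\prod_{i=1}^{k}u_i^{\epsilon_i}$ if $\epsilon_k=-1$. For $s\in Y$, the Fox derivative of $u$ is $\frac{\partial u}{\partial s}=\sum_{k:\,u_k=s}\epsilon_k u_{(k)}\in\mathbb{Z}[F]$ (independent of the word representing $u$). Below, $\frac{\partial u}{\partial s}$ denotes its image in the group ring $\mathbb{Z}[F/N]$; this image depends only on the class of $u$ in $F/N'$. The polynomials $f_u$. For $u\in F$, define in the commutative polynomial ring $\mathbb{Z}[F/N][(t_x)_{x\in X}]$ $$f_u=\Bigl(1-\sum_{s\in Y}\frac{\partial u}{\partial s}\Bigr)+\sum_{s\in Y}\frac{\partial u}{\partial s}\,t_s,$$ where $t_s=t_{x_1}\cdots t_{x_i}$ if $s=x_1\circ\cdots\circ x_i$ with $x_1,\dots,x_i\in X$. The wire $\mathcal{W}(X)$. Let $\mathrm{ev}_1,\mathrm{ev}_X\colon\mathbb{Z}[F/N][(t_x)_{x\in X}]\to\mathbb{Z}[F/N]$ be the $\mathbb{Z}[F/N]$-algebra morphisms given by $t_x\mapsto1$ and $t_x\mapsto[x]$ respectively. Then $\mathcal{W}(X)=\mathrm{ev}_1^{-1}(1)\cap\mathrm{ev}_X^{-1}(F/N)$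 (with $F/N$ identified with its image in $\mathbb{Z}[F/N]$), equipped with $f\star g=f+\mathrm{ev}_X(f)(g-1)$ and $f\circ g=f\cdot g$; this is a commutative wire, and $f_u\in\mathcal{W}(X)$ for all $u\in F$. *)

(* Defs.v *)
From HB Require Import structures.
From mathcomp Require Import all_boot ssralg ssrint finmap.
From mathcomp.multinomials Require Import monalg.
From mathcomp.classical Require Import boolp.

Set Implicit Arguments.
Unset Strict Implicit.
Unset Printing Implicit Defensive.

Import GRing.Theory.

(* A wire is written multiplicatively: the group operation "star" is [x * y]
   in [group_scope]. *)
HB.mixin Record Group_isWire W of Group W := {
  circ : W -> W -> W;
  circA : associative circ;
  circMr : forall a b c : W,
    circ a (b * c)%g = (circ a b * a^-1 * circ a c)%g;
  circMl : forall a b c : W,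
    circ (b * c)%g a = (circ b a * a^-1 * circ c a)%g
}.

#[short(type="wireType")]
HB.structure Definition Wire := { W of Group W & Group_isWire W }.

HB.mixin Record Wire_isCommutative W of Wire W := {
  circC : commutative (@circ W)
}.

#[short(type="comWireType")]
HB.structure Definition ComWire := { W of Wire W & Wire_isCommutative W }.

Definition wire_morphism (V W : wireType) (f : V -> W) : Prop :=
  {morph f : x y / (x * y)%g >-> (x * y)%g} /\
  {morph f : x y / circ x y >-> circ x y}.

Section GeneratedSubgroups.
Local Open Scope group_scope.
Variable G : groupType.
Implicit Types (A : G -> Prop) (S : {pred G}).

Definition normal_closed S : Prop :=
  group_closed S /\ (forall x y : G, x \in S -> x ^ y \in S).

Definition subgroup_gen A : {pred G} := fun x =>
  `[< forall S, group_closed S -> (forall a, A a -> a \in S) -> x \in S >].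

Definition normal_gen A : {pred G} := fun x =>
  `[< forall S, normal_closed S -> (forall a, A a -> a \in S) -> x \in S >].

Definition derived_pred S : {pred G} :=
  subgroup_gen (fun z => exists x y, [/\ x \in S, y \in S & z = [~ x, y]]).

Lemma subgroup_genP A x :
  reflect (forall S, group_closed S -> (forall a, A a -> a \in S) -> x \in S)
          (x \in subgroup_gen A).
Proof. exact: asboolP. Qed.

Lemma normal_genP A x :
  reflect (forall S, normal_closed S -> (forall a, A a -> a \in S) -> x \in S)
          (x \in normal_gen A).
Proof. exact: asboolP. Qed.

Lemma subgroup_gen_closed A : group_closed (subgroup_gen A).
Proof.
split=> [|x y /subgroup_genP Ax /subgroup_genP Ay];
  apply/subgroup_genP => S [S1 SF] AS //.
by apply: (SF); [exact: Ax | exact: Ay].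
Qed.

Lemma mem_subgroup_gen A a : A a -> a \in subgroup_gen A.
Proof. by move=> Aa; apply/subgroup_genP => S _; apply. Qed.

Lemma subgroup_gen_sub A S :
  group_closed S -> (forall a, A a -> a \in S) ->
  {subset subgroup_gen A <= S}.
Proof. by move=> gS AS x /subgroup_genP; apply. Qed.

Lemma normal_gen_closed A : normal_closed (normal_gen A).
Proof.
split=> [|x y /normal_genP Ax]; last first.
  by apply/normal_genP => S nS AS; apply: nS.2; apply: Ax.
split=> [|x y /normal_genP Ax /normal_genP Ay]; apply/normal_genP => S nS AS.
  exact: nS.1.1.
by apply: (nS.1.2); [exact: Ax | exact: Ay].
Qed.

Lemma mem_normal_gen A a : A a -> a \in normal_gen A.
Proof. by move=> Aa; apply/normal_genP => S _; apply. Qed.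

Lemma derived_pred_normal S : normal_closed S -> normal_closed (derived_pred S).
Proof.
move=> nS; split=> [|x y]; first exact: subgroup_gen_closed.
pose T : {pred G} := fun z => z ^ y \in derived_pred S.
suff: {subset derived_pred S <= T} by apply.
apply: subgroup_gen_sub => [|_ [u [v [Su Sv ->]]]].
  split=> [|u v Tu Tv].
    by rewrite unfold_in conj1g; apply: (subgroup_gen_closed _).1.
  by rewrite unfold_in conjMg conjVg; apply: (subgroup_gen_closed _).2.
rewrite unfold_in conjRg; apply: mem_subgroup_gen.
by exists (u ^ y), (v ^ y); split; first [exact: nS.2 | by []].
Qed.

End GeneratedSubgroups.

Record normalSubgroup (G : groupType) := NormalSubgroup {
  nsub_pred :> {pred G};
  nsub_normal : normal_closed nsub_pred
}.

Section QuotientGroup.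
Local Open Scope group_scope.
Local Open Scope quotient_scope.
Variables (G : groupType) (H : normalSubgroup G).

Lemma nsub1 : 1 \in (H : {pred G}).
Proof. exact: (nsub_normal H).1.1. Qed.

Lemma nsubV x : x \in (H : {pred G}) -> x^-1 \in (H : {pred G}).
Proof. by move=> Hx; apply: (group_closedV (nsub_normal H).1). Qed.

Lemma nsubM x y : x \in (H : {pred G}) -> y \in (H : {pred G}) ->
  x * y \in (H : {pred G}).
Proof. by move=> Hx Hy; apply: (group_closedM (nsub_normal H).1). Qed.

Lemma nsubJ x y : x \in (H : {pred G}) -> x ^ y \in (H : {pred G}).
Proof. exact: (nsub_normal H).2. Qed.

Definition coset_rel : rel G := fun x y => x^-1 * y \in (H : {pred G}).

Lemma coset_rel_refl : reflexive coset_rel.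
Proof. by move=> x; rewrite /coset_rel mulVg nsub1. Qed.

Lemma coset_rel_sym : symmetric coset_rel.
Proof.
by move=> x y; apply/idP/idP => /nsubV; rewrite invgM invgK.
Qed.

Lemma coset_rel_trans : transitive coset_rel.
Proof.
by move=> y x z xy yz; have := nsubM xy yz; rewrite mulgA mulgK.
Qed.

Canonical coset_equiv :=
  EquivRel coset_rel coset_rel_refl coset_rel_sym coset_rel_trans.

Definition quotientGroup := {eq_quot coset_equiv}.

HB.instance Definition _ := Choice.on quotientGroup.
HB.instance Definition _ := EqQuotient.on quotientGroup.

Lemma quot_eqP x y :
  reflect (\pi_quotientGroup x = \pi_quotientGroup y)
          (x^-1 * y \in (H : {pred G})).
Proof. exact: (@eqquotP _ coset_equiv quotientGroup). Qed.

Definition quot_mul := lift_op2 quotientGroup (fun x y : G => x * y).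
Definition quot_inv := lift_op1 quotientGroup (fun x : G => x^-1).

Lemma quot_piM x y :
  \pi_quotientGroup (x * y) =
  quot_mul (\pi_quotientGroup x) (\pi_quotientGroup y).
Proof.
unlock quot_mul.
have /esym/quot_eqP Hx := reprK (\pi_quotientGroup x).
have /esym/quot_eqP Hy := reprK (\pi_quotientGroup y).
apply/quot_eqP.
move: (repr (\pi_quotientGroup x)) (repr (\pi_quotientGroup y)) Hx Hy.
move=> x' y' Hx Hy.
have -> : (x * y)^-1 * (x' * y') = (x^-1 * x') ^ y * (y^-1 * y').
  by rewrite /conjg invgM -!mulgA mulVKg.
by apply: nsubM => //; apply: nsubJ.
Qed.

Lemma quot_piV x : \pi_quotientGroup x^-1 = quot_inv (\pi_quotientGroup x).
Proof.
unlock quot_inv.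
have /quot_eqP Hx := reprK (\pi_quotientGroup x).
apply/quot_eqP; move: (repr _) Hx => x' Hx; rewrite invgK.
have -> : x * x'^-1 = (x'^-1 * x) ^ (x'^-1).
  by rewrite /conjg invgK -!mulgA mulVKg.
exact: nsubJ.
Qed.

Lemma quot_mulA : associative quot_mul.
Proof.
elim/quotW=> x; elim/quotW=> y; elim/quotW=> z.
by rewrite -!quot_piM mulgA.
Qed.

Lemma quot_mul1 : left_id (\pi_quotientGroup 1) quot_mul.
Proof. by elim/quotW=> x; rewrite -quot_piM mul1g. Qed.

Lemma quot_mulr1 : right_id (\pi_quotientGroup 1) quot_mul.
Proof. by elim/quotW=> x; rewrite -quot_piM mulg1. Qed.

Lemma quot_mulV : left_inverse (\pi_quotientGroup 1) quot_inv quot_mul.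
Proof. by elim/quotW=> x; rewrite -quot_piV -quot_piM mulVg. Qed.

Lemma quot_mulrV : right_inverse (\pi_quotientGroup 1) quot_inv quot_mul.
Proof. by elim/quotW=> x; rewrite -quot_piV -quot_piM mulgV. Qed.

HB.instance Definition _ := isGroup.Build quotientGroup
  quot_mulA quot_mul1 quot_mulr1 quot_mulV quot_mulrV.

Lemma piM : {morph \pi_quotientGroup : x y / x * y}.
Proof. exact: quot_piM. Qed.

Lemma piV : {morph \pi_quotientGroup : x / x^-1}.
Proof. exact: quot_piV. Qed.

Lemma pi_eq1 x : \pi_quotientGroup x = 1 <-> x \in (H : {pred G}).
Proof.
have -> : (x \in (H : {pred G})) = (1^-1 * x \in (H : {pred G})).
  by rewrite invg1 mul1g.
by split=> [/esym/quot_eqP | /quot_eqP/esym].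
Qed.

End QuotientGroup.

Section FreeGroup.
Variable Y : choiceType.

(* The letter [(y, b)] stands for y if [b] is true, for y^-1 otherwise. *)
Definition letter : Type := (Y * bool)%type.
HB.instance Definition _ := Choice.on letter.
Implicit Types (c : letter) (w s t : seq letter).

Definition linv c : letter := (c.1, ~~ c.2).

Definition reduced w := sorted (fun a b => b != linv a) w.

Definition push c w : seq letter :=
  if w is c' :: w' then if c' == linv c then w' else c :: w else [:: c].

Definition reduce w : seq letter := foldr push [::] w.

Lemma linvK : involutive linv.
Proof. by case=> y b; rewrite /linv /= negbK. Qed.

Lemma push_reduced c w : reduced w -> reduced (push c w).
Proof.
case: w => [|c' w] //=; case: ifPn => [_ |Hc] rw; last by rewrite /= Hc.
exact: path_sorted rw.
Qed.

Lemma foldr_push_reduced r w : reduced r -> reduced (foldr push r w).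
Proof. by move=> rr; elim: w => [|c w IH] //=; apply: push_reduced. Qed.

Lemma reduce_reduced w : reduced (reduce w).
Proof. exact: foldr_push_reduced. Qed.

Lemma reduce_id w : reduced w -> reduce w = w.
Proof.
elim: w => [|c w IH] //= rw; rewrite -/(reduce w) IH;
  last exact: path_sorted rw.
by case: w rw {IH} => [|c' w] //= /andP[/negPf-> _].
Qed.

Lemma pushK c w : reduced w -> push (linv c) (push c w) = w.
Proof.
case: w => [|c' w] /=; first by rewrite linvK eqxx.
case: eqP => [->|_] /=; last by rewrite linvK eqxx.
by case: w => [|d w] //=; rewrite linvK => /andP[/negPf->].
Qed.

Lemma pushVK c w : reduced w -> push c (push (linv c) w) = w.
Proof. by move=> rw; rewrite -{1}[c]linvK pushK. Qed.

Lemma foldr_push c t r : reduced r ->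
  foldr push r (push c t) = push c (foldr push r t).
Proof.
move=> rr; case: t => [|c' t] //=.
by case: eqP => [->|//]; rewrite pushVK ?foldr_push_reduced.
Qed.

Lemma foldr_reduce s r : reduced r -> foldr push r (reduce s) = foldr push r s.
Proof.
move=> rr; elim: s => [|c s IH] //=.
by rewrite -/(reduce s) foldr_push ?IH.
Qed.

Lemma reduce_catl s t : reduce (reduce s ++ t) = reduce (s ++ t).
Proof. by rewrite /reduce !foldr_cat foldr_reduce // reduce_reduced. Qed.

Lemma reduce_catr s t : reduce (s ++ reduce t) = reduce (s ++ t).
Proof.
by rewrite /reduce !foldr_cat [foldr _ _ (foldr _ _ t)]reduce_id
  ?reduce_reduced.
Qed.

Record freeGroup : predArgType := FreeGroup {
  fg_word :> seq letter;
  _ : reduced fg_word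
}.

HB.instance Definition _ := [isSub for fg_word].
HB.instance Definition _ := [Choice of freeGroup by <:].

Definition fg_of w : freeGroup := FreeGroup (reduce_reduced w).

Definition fg_mul (u v : freeGroup) : freeGroup := fg_of (u ++ v).
Definition fg_inv (u : freeGroup) : freeGroup := fg_of (rev (map linv u)).

Lemma fg_ofK (u : freeGroup) : fg_of u = u.
Proof. by apply: val_inj; rewrite /= reduce_id; case: u. Qed.

Lemma fg_of_mul s t : fg_mul (fg_of s) (fg_of t) = fg_of (s ++ t).
Proof. by apply: val_inj; rewrite /= reduce_catl reduce_catr. Qed.

Lemma fg_mulA : associative fg_mul.
Proof.
by move=> u v w; rewrite -[u]fg_ofK -[v]fg_ofK -[w]fg_ofK !fg_of_mul catA.
Qed.

Lemma fg_mul1 : left_id (fg_of [::]) fg_mul.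
Proof. by move=> u; rewrite -[u]fg_ofK fg_of_mul. Qed.

Lemma fg_mulr1 : right_id (fg_of [::]) fg_mul.
Proof. by move=> u; rewrite -[u]fg_ofK fg_of_mul cats0. Qed.

Lemma fg_mulV : left_inverse (fg_of [::]) fg_inv fg_mul.
Proof.
move=> u; rewrite /fg_inv -{2}[u]fg_ofK fg_of_mul; apply: val_inj => /=.
elim: {u}(fg_word u) => [|c w IH] //=.
by rewrite rev_cons cat_rcons /reduce foldr_cat /= pushK ?reduce_reduced //
   -foldr_cat.
Qed.

Lemma fg_invK : involutive fg_inv.
Proof.
move=> u.
rewrite -[LHS]fg_mulr1 -(fg_mulV u) fg_mulA fg_mulV fg_mul1 //.
Qed.

Lemma fg_mulrV : right_inverse (fg_of [::]) fg_inv fg_mul.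
Proof. by move=> u; rewrite -{1}[u]fg_invK fg_mulV. Qed.

HB.instance Definition _ := isGroup.Build freeGroup
  fg_mulA fg_mul1 fg_mulr1 fg_mulV fg_mulrV.

Definition fg_gen (y : Y) : freeGroup := fg_of [:: (y, true)].

Local Open Scope group_scope.

Lemma fg_of_cat s t : fg_of (s ++ t) = fg_of s * fg_of t.
Proof. by rewrite -fg_of_mul. Qed.

Lemma fg_of_cons c w :
  fg_of (c :: w) = (if c.2 then fg_gen c.1 else (fg_gen c.1)^-1) * fg_of w.
Proof.
by rewrite -cat1s fg_of_cat; congr (_ * _); case: c => y [].
Qed.

Lemma fg_ind (P : freeGroup -> Prop) :
  P 1 -> (forall y, P (fg_gen y)) ->
  (forall u v, P u -> P v -> P (u * v)) -> (forall u, P u -> P u^-1) ->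
  forall u, P u.
Proof.
move=> P1 Pg PM PV u; rewrite -[u]fg_ofK.
elim: {u}(fg_word u) => [|c w IH] //; rewrite fg_of_cons; apply: PM => //.
by case: c.2; [apply: Pg | apply/PV/Pg].
Qed.

(* [fg_lift f u] is the product of the f(u_i)^(e_i) when u is the product of the
   u_i^(e_i); by [fg_lift_of] every word representing u gives the same value. *)
Section Lift.
Variables (G : groupType) (f : Y -> G).

Definition lift_letter c : G := if c.2 then f c.1 else (f c.1)^-1.

Definition fg_lift (u : freeGroup) : G := \prod_(c <- fg_word u) lift_letter c.

Lemma lift_letterV c : lift_letter (linv c) = (lift_letter c)^-1.
Proof. by case: c => y []; rewrite /lift_letter //= invgK. Qed.

Lemma fg_lift_of w : fg_lift (fg_of w) = \prod_(c <- w) lift_letter c.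
Proof.
rewrite /fg_lift /=; elim: w => [|c w IH] //=; rewrite -/(reduce w).
rewrite big_cons -IH; case: (reduce w) => [|c' w'] /=.
  by rewrite big_seq1 big_nil mulg1.
case: eqP => [->|_]; last by rewrite big_cons.
by rewrite big_cons lift_letterV mulVKg.
Qed.

Lemma fg_liftM : {morph fg_lift : u v / u * v}.
Proof.
by move=> u v; rewrite -[u]fg_ofK -[v]fg_ofK -fg_of_cat !fg_lift_of big_cat.
Qed.

Lemma fg_lift_gen y : fg_lift (fg_gen y) = f y.
Proof. by rewrite fg_lift_of big_seq1. Qed.

End Lift.

Lemma morphg1 (G : groupType) (f : freeGroup -> G) :
  {morph f : u v / u * v} -> f 1 = 1.
Proof. by move=> fM; apply: (mulgI (f 1)); rewrite -fM !mulg1. Qed.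

Lemma morphgV (G : groupType) (f : freeGroup -> G) :
  {morph f : u v / u * v} -> {morph f : u / u^-1}.
Proof.
by move=> fM u; apply: (mulgI (f u)); rewrite -fM !mulgV morphg1.
Qed.

Lemma fg_morph_ext (G : groupType) (f g : freeGroup -> G) :
  {morph f : u v / u * v} -> {morph g : u v / u * v} ->
  (forall y, f (fg_gen y) = g (fg_gen y)) -> f =1 g.
Proof.
move=> fM gM fg; elim/fg_ind => [|//|u v IHu IHv|u IHu].
- by rewrite !morphg1.
- by rewrite fM gM IHu IHv.
- by rewrite !morphgV // IHu.
Qed.

End FreeGroup.

Section FN.
Local Open Scope group_scope.
Local Open Scope quotient_scope.
Variable X : choiceType.

(* The free commutative semigroup on X, as the monomials other than 1. *)
Record freeComSemigroup : predArgType := FreeComSemigroup {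
  fcs_monom :> {cmonom X};
  _ : fcs_monom != mone
}.

HB.instance Definition _ := [isSub for fcs_monom].
HB.instance Definition _ := [Choice of freeComSemigroup by <:].

Local Notation Y := freeComSemigroup.

Lemma fcs_mul_subproof (s t : Y) : mmul (fcs_monom s) (fcs_monom t) != mone.
Proof. by rewrite cmM_eq1; case: s => s /= /negPf->. Qed.

Definition fcs_mul (s t : Y) : Y := FreeComSemigroup (fcs_mul_subproof s t).

Lemma fcs_mulA : associative fcs_mul.
Proof. by move=> s t u; apply: val_inj; apply: mulmA. Qed.

Lemma fcs_mulC : commutative fcs_mul.
Proof. by move=> s t; apply: val_inj; apply: mulmC. Qed.

Lemma fcs_gen_subproof (x : X) : ucm x != mone.
Proof. by rewrite cm1_eq1. Qed.

Definition fcs_gen (x : X) : Y := FreeComSemigroup (fcs_gen_subproof x).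

Definition Fgroup := freeGroup Y.
HB.instance Definition _ := Group.on Fgroup.

Definition circ_gen (u : Fgroup) (l : Y) : Fgroup :=
  fg_lift (fun y => fg_gen (fcs_mul y l) * (fg_gen l)^-1 : Fgroup) u
  * fg_gen l.

Definition circ_l (u v : Fgroup) : Fgroup :=
  u * fg_lift (fun y => u^-1 * circ_gen u y) v.

Definition Nrel (z : Fgroup) : Prop :=
  exists m l : Y, z = (fg_gen m)^-1 * fg_gen (fcs_mul m l) * (fg_gen l)^-1.

Definition Nsub : normalSubgroup Fgroup :=
  NormalSubgroup (normal_gen_closed Nrel).

Definition N'sub : normalSubgroup Fgroup :=
  NormalSubgroup (derived_pred_normal (nsub_normal Nsub)).

Definition FN := quotientGroup Nsub.
HB.instance Definition _ := Group.on FN.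
HB.instance Definition _ := EqQuotient.on FN.

Definition FN' := quotientGroup N'sub.
HB.instance Definition _ := Group.on FN'.
HB.instance Definition _ := EqQuotient.on FN'.

Local Notation piN := (\pi_FN : Fgroup -> FN).
Local Notation piN' := (\pi_FN' : Fgroup -> FN').

Lemma piNM : {morph piN : u v / u * v}. Proof. exact: piM. Qed.
Lemma piNV : {morph piN : u / u^-1}. Proof. exact: piV. Qed.
Lemma piN'M : {morph piN' : u v / u * v}. Proof. exact: piM. Qed.
Lemma piN'V : {morph piN' : u / u^-1}. Proof. exact: piV. Qed.

Lemma piN_rel m l :
  piN (fg_gen (fcs_mul m l)) = piN (fg_gen m) * piN (fg_gen l).
Proof.
have /(pi_eq1 Nsub) : (fg_gen m : Fgroup)^-1 * fg_gen (fcs_mul m l)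
    * (fg_gen l)^-1 \in (Nsub : {pred Fgroup}).
  by apply: mem_normal_gen; exists m, l.
rewrite -/FN !piNM !piNV.
move=> /(congr1 (fun z => piN (fg_gen m) * z * piN (fg_gen l))).
by rewrite mulg1 mulgA mulgVK mulVKg.
Qed.

Lemma FN_mulC (a b : FN) : a * b = b * a.
Proof.
have PV (c d : FN) : commute c d -> commute c^-1 d.
  by move=> cd; apply/commute_sym/commuteV/commute_sym.
move: a b; elim/quotW=> u; elim/quotW=> v; rewrite -/(commute _ _).
elim/fg_ind: u v => [v|y|u v IHu IHv w|u IHu v].
- by rewrite /commute -!piNM mul1g mulg1.
- elim/fg_ind => [|z|u v IHu IHv|u IHu].
  + by rewrite /commute -!piNM mul1g mulg1.
  + by rewrite /commute -!piN_rel fcs_mulC.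
  + by rewrite piNM; apply: commuteM.
  + by rewrite piNV; apply: commuteV.
- by rewrite piNM; apply/commute_sym/commuteM; apply/commute_sym.
- by rewrite piNV; apply: PV.
Qed.

Lemma piN_fixes_N' (f : Fgroup -> Fgroup) :
  {morph f : u v / u * v} -> (forall u, piN (f u) = piN u) ->
  forall u v, piN' u = piN' v -> piN' (f u) = piN' (f v).
Proof.
move=> fM fN u v /(@quot_eqP _ N'sub _ _) uv; apply/(@quot_eqP _ N'sub _ _).
rewrite -(morphgV fM) -fM; move: (u^-1 * v) uv => {u v}.
apply: (subgroup_gen_sub (S := [pred u | f u \in (N'sub : {pred Fgroup})])).
  split=> [|u v]; rewrite !inE; first by rewrite (morphg1 fM) nsub1.
  by rewrite fM (morphgV fM) => fu fv; apply: nsubM => //; apply: nsubV.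
move=> _ [u [v [Nu Nv ->]]]; rewrite inE; apply: mem_subgroup_gen.
exists (f u), (f v); split.
- by apply/(pi_eq1 Nsub); rewrite -/FN fN; apply/(pi_eq1 Nsub).
- by apply/(pi_eq1 Nsub); rewrite -/FN fN; apply/(pi_eq1 Nsub).
- by rewrite /commg /conjg !fM !(morphgV fM).
Qed.

Lemma piN_circ_gen u y : piN (circ_gen u y) = piN u * piN (fg_gen y).
Proof.
rewrite piNM; congr (_ * _); move: u.
apply: fg_morph_ext => [u v|u v|z] /=; rewrite ?fg_liftM ?piNM //.
by rewrite fg_lift_gen piNM piNV piN_rel mulgK.
Qed.

Lemma piN_circ_l u v : piN (circ_l u v) = piN u * piN v.
Proof.
rewrite piNM; congr (_ * _); move: v.
apply: fg_morph_ext => [v w|v w|z] /=; rewrite ?fg_liftM ?piNM //.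
by rewrite fg_lift_gen piNM piNV piN_circ_gen mulKg.
Qed.

Lemma circ_gen_wd u v y :
  piN' u = piN' v -> piN' (circ_gen u y) = piN' (circ_gen v y).
Proof.
move=> uv; rewrite !piN'M; congr (_ * _); move: uv.
apply: piN_fixes_N' => [|w]; first exact: fg_liftM.
have := piN_circ_gen w y; rewrite piNM; exact: mulIg.
Qed.

Lemma circ_l_wd u u' v v' : piN' u = piN' u' -> piN' v = piN' v' ->
  piN' (circ_l u v) = piN' (circ_l u' v').
Proof.
move=> uu' vv'; have -> : piN' (circ_l u v) = piN' (circ_l u v').
  rewrite !piN'M; congr (_ * _); move: vv'.
  apply: piN_fixes_N' => [|w]; first exact: fg_liftM.
  have := piN_circ_l u w; rewrite piNM; exact: mulgI.
rewrite !piN'M uu'; congr (_ * _); move: v' {v vv'}.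
apply: fg_morph_ext => [v w|v w|z] /=; rewrite ?fg_liftM ?piN'M //.
rewrite !fg_lift_gen (piN'M u^-1) (piN'M u'^-1) !piN'V uu'.
by rewrite (circ_gen_wd _ uu').
Qed.

Definition FN'_circ := lift_op2 FN' circ_l.

Lemma FN'_circE u v : FN'_circ (piN' u) (piN' v) = piN' (circ_l u v).
Proof. by unlock FN'_circ; apply: circ_l_wd; rewrite reprK. Qed.

Definition rho := lift_op11 FN' FN (fun u : Fgroup => u).

Lemma rhoE u : rho (piN' u) = piN u.
Proof.
unlock rho.
have /(@quot_eqP _ N'sub _ _) : piN' u = piN' (repr (piN' u)) by rewrite reprK.
move=> H; apply/esym/(@quot_eqP _ Nsub _ _).
move: H; apply: subgroup_gen_sub; first exact: (nsub_normal Nsub).1.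
move=> _ [x [y [Nx Ny ->]]]; apply: nsubM; last exact: nsubJ.
exact: nsubV.
Qed.

Lemma rhoM : {morph rho : a b / a * b}.
Proof.
elim/quotW=> u; elim/quotW=> v.
by rewrite -(piN'M u v) !rhoE piNM.
Qed.

Lemma rhoV : {morph rho : a / a^-1}.
Proof. by elim/quotW=> u; rewrite -(piN'V u) !rhoE piNV. Qed.

Lemma rho_circ a b : rho (FN'_circ a b) = rho a * rho b.
Proof.
move: a b; elim/quotW=> u; elim/quotW=> v.
by rewrite FN'_circE !rhoE piN_circ_l.
Qed.

Lemma rho_ker_comm a b : rho a = 1 -> rho b = 1 -> a * b = b * a.
Proof.
move: a b; elim/quotW=> u; elim/quotW=> v.
rewrite !rhoE => /(pi_eq1 Nsub) Nu /(pi_eq1 Nsub) Nv.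
apply/(commgP (x := piN' u) (y := piN' v))/eqP.
rewrite /commg /conjg -!piN'V -!piN'M; apply/(pi_eq1 N'sub).
by apply: mem_subgroup_gen; exists u, v.
Qed.

Definition affine (f : FN' -> FN') : Prop :=
  forall a b, f (a * b) = f a * (f 1)^-1 * f b.

Lemma affineV f a : affine f -> f a^-1 = f 1 * (f a)^-1 * f 1.
Proof.
move=> fM; have := fM a a^-1; rewrite mulgV => fE.
by rewrite [X in _ * X]fE mulgA mulgA mulgVK mulgV mul1g.
Qed.

Lemma affine_comp f g : affine f -> affine g -> affine (g \o f).
Proof.
move=> fM gM a b; rewrite /= fM gM gM (affineV _ gM) !mulgA.
by rewrite mulgVK mulgK.
Qed.

Lemma affine_ext f g : affine f -> affine g -> f 1 = g 1 ->
  (forall y, f (piN' (fg_gen y)) = g (piN' (fg_gen y))) -> f =1 g.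
Proof.
move=> fM gM fg1 fg; elim/quotW; elim/fg_ind => [//|//|u v IHu IHv|u IHu].
- by rewrite (piN'M u v) fM gM IHu IHv fg1.
- by rewrite (piN'V u) (affineV _ fM) (affineV _ gM) IHu fg1.
Qed.

Lemma FN'_circr1 a : FN'_circ a 1 = a.
Proof.
elim/quotW: a => u; have -> : 1 = piN' 1 by []; rewrite FN'_circE /circ_l.
by rewrite (morphg1 (@fg_liftM _ _ _)) mulg1.
Qed.

Lemma FN'_circMr a b c :
  FN'_circ a (b * c) = FN'_circ a b * a^-1 * FN'_circ a c.
Proof.
move: a b c; elim/quotW=> u; elim/quotW=> v; elim/quotW=> w.
rewrite -(piN'M v w) -(piN'V u) !FN'_circE -!piN'M; congr (\pi_FN' _).
by rewrite /circ_l fg_liftM !mulgA mulgVK.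
Qed.

Lemma FN'_circr_affine a : affine (FN'_circ a).
Proof. by move=> b c; rewrite FN'_circMr FN'_circr1. Qed.

Lemma FN'_circMl a b c :
  FN'_circ (b * c) a = FN'_circ b a * a^-1 * FN'_circ c a.
Proof.
move: a b c; elim/quotW; elim/fg_ind => [b c|y|u v IHu IHv b c|u IHu b c].
- have -> : \pi_FN' 1 = 1 :> FN' by [].
  by rewrite !FN'_circr1 invg1 mulg1.
- elim/quotW=> u; elim/quotW=> v; rewrite -(piN'M u v).
  rewrite !FN'_circE -(piN'V (fg_gen y)) -!piN'M; congr (\pi_FN' _).
  have cE w : circ_l w (fg_gen y) = circ_gen w y.
    by rewrite /circ_l fg_lift_gen mulVKg.
  by rewrite !cE /circ_gen fg_liftM !mulgA mulgK.
- move: IHu IHv; rewrite (piN'M u v).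
  move: (piN' u) (piN' v) => {u v} y a IHy IHa.
  rewrite !FN'_circMr IHy IHa.
  have E : (y^-1 * FN'_circ c y * c^-1) * (b^-1 * FN'_circ b a * a^-1)
      = (b^-1 * FN'_circ b a * a^-1) * (y^-1 * FN'_circ c y * c^-1).
    apply: rho_ker_comm; rewrite !rhoM !rhoV rho_circ;
      last by rewrite mulKg mulgV.
    by rewrite [rho c * _]FN_mulC mulKg mulgV.
  rewrite !invgM !mulgA.
  move/(congr1 (fun z => FN'_circ b y * z * FN'_circ c a)): E.
  by rewrite !mulgA.
- move: IHu; rewrite (piN'V u); move: (piN' u) => {u} y IHy.
  have iV d : FN'_circ d y^-1 = d * (FN'_circ d y)^-1 * d.
    by rewrite (affineV _ (@FN'_circr_affine d)) FN'_circr1.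
  rewrite !iV IHy !invgM !invgK.
  have : (c * (FN'_circ c y)^-1 * y) * ((FN'_circ b y)^-1 * b * y)
      = ((FN'_circ b y)^-1 * b * y) * (c * (FN'_circ c y)^-1 * y).
    apply: rho_ker_comm; rewrite !rhoM !rhoV rho_circ -mulgA.
      by rewrite [LHS]FN_mulC -mulgA [rho y * _]FN_mulC mulVg.
    by rewrite mulVg.
  by move/(congr1 (fun z => b * z * y^-1 * c)); rewrite !mulgA !mulgK.
Qed.

Lemma FN'_circ1 a : FN'_circ 1 a = a.
Proof.
have := FN'_circMl a 1 1; rewrite mulg1 -{1}[FN'_circ 1 a]mulg1 -mulgA.
by move/mulgI/esym/mulg1_eq; rewrite invgK.
Qed.

Lemma FN'_circl_affine a : affine (FN'_circ^~ a).
Proof. by move=> b c; rewrite FN'_circMl FN'_circ1. Qed.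

Lemma FN'_circ_gen y z : FN'_circ (piN' (fg_gen y)) (piN' (fg_gen z))
  = piN' (fg_gen (fcs_mul y z)).
Proof.
by rewrite FN'_circE /circ_l /circ_gen !fg_lift_gen mulVKg mulgVK.
Qed.

Lemma FN'_circC : commutative FN'_circ.
Proof.
move=> a; apply: affine_ext; [exact: FN'_circr_affine
  | exact: FN'_circl_affine | by rewrite FN'_circ1 FN'_circr1 | move=> y].
move: a; apply: affine_ext; [exact: FN'_circl_affine
  | exact: FN'_circr_affine | by rewrite FN'_circ1 FN'_circr1 | move=> z].
by rewrite !FN'_circ_gen fcs_mulC.
Qed.

Lemma FN'_circA : associative FN'_circ.
Proof.
move=> a b c.
have L d := @FN'_circl_affine d; have R d := @FN'_circr_affine d.
move: a; apply: affine_ext; first exact: L.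
- exact: (affine_comp (L b) (L c)).
- by rewrite !FN'_circ1.
move=> x; move: b; apply: affine_ext.
- exact: (affine_comp (L c) (R _)).
- exact: (affine_comp (R _) (L c)).
- by rewrite FN'_circ1 FN'_circr1.
move=> y; move: c; apply: affine_ext.
- exact: (affine_comp (R _) (R _)).
- exact: R.
- by rewrite !FN'_circr1.
by move=> z; rewrite !FN'_circ_gen fcs_mulA.
Qed.

HB.instance Definition _ := Group_isWire.Build FN'
  FN'_circA FN'_circMr FN'_circMl.
HB.instance Definition _ := Wire_isCommutative.Build FN' FN'_circC.

End FN.

HB.mixin Record Group_isAbelian G of Group G := {
  abg_mulC : forall x y : G, (x * y = y * x)%g
}.

#[short(type="abGroupType")]
HB.structure Definition AbGroup := { G of Group G & Group_isAbelian G }.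

HB.instance Definition _ (X : choiceType) :=
  Group_isAbelian.Build (FN X) (@FN_mulC X).

(* [{malg int[G]}] only has a ring structure when G is a [monomType], which
   excludes groups; the group ring is the same additive group with the
   convolution product. *)
Definition groupRing (G : groupType) : Type := {malg int[G]}.

HB.lock Definition gr_elt (G : groupType) (x : G) : groupRing G :=
  mkmalgU x (1 : int)%R.

Arguments gr_elt {G} x.

Section GroupRing.
Local Open Scope fset_scope.
Local Open Scope ring_scope.
Variable G : groupType.

HB.instance Definition _ := Choice.on (groupRing G).
HB.instance Definition _ := GRing.Zmodule.on (groupRing G).

Implicit Types (g : groupRing G) (x y : G).

Local Notation cnv g1 g2 k1 k2 :=
  (<< g1@_k1 * g2@_k2 *g (k1 * k2)%g >> : groupRing G).

Definition gr_mul g1 g2 : groupRing G :=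
  \sum_(k1 <- msupp g1) \sum_(k2 <- msupp g2) cnv g1 g2 k1 k2.

Lemma gr_mulw (d1 d2 : {fset G}) g1 g2 :
  msupp g1 `<=` d1 -> msupp g2 `<=` d2 ->
  gr_mul g1 g2 = \sum_(k1 <- d1) \sum_(k2 <- d2) cnv g1 g2 k1 k2.
Proof.
move=> le_d1 le_d2; rewrite /gr_mul (big_fset_incl _ le_d1) /=.
  apply/eq_bigr=> k1 _; apply/big_fset_incl => // k _ /mcoeff_outdom ->.
  by rewrite mulr0 monalgU0.
move=> k _ /mcoeff_outdom g1k.
by rewrite big1 => // k' _; rewrite g1k mul0r monalgU0.
Qed.

Lemma gr_mulDl : left_distributive gr_mul +%R.
Proof.
move=> g1 g2 g.
rewrite (gr_mulw (msuppD_le _ _) (fsubset_refl _)).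
rewrite (gr_mulw (fsubsetUl _ (msupp g2)) (fsubset_refl _)).
rewrite (gr_mulw (fsubsetUr (msupp g1) _) (fsubset_refl _)).
rewrite -big_split /=; apply/eq_bigr=> k1 _.
rewrite -big_split /=; apply/eq_bigr=> k2 _.
by rewrite mcoeffD mulrDl monalgUD.
Qed.

Lemma gr_mulDr : right_distributive gr_mul +%R.
Proof.
move=> g g1 g2.
rewrite (gr_mulw (fsubset_refl _) (msuppD_le _ _)).
rewrite (gr_mulw (fsubset_refl _) (fsubsetUl _ (msupp g2))).
rewrite (gr_mulw (fsubset_refl _) (fsubsetUr (msupp g1) _)).
rewrite -big_split /=; apply/eq_bigr=> k1 _.
rewrite -big_split /=; apply/eq_bigr=> k2 _.
by rewrite mcoeffD mulrDr monalgUD.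
Qed.

Lemma gr_mul0 : left_zero 0 gr_mul.
Proof. by move=> g; rewrite /gr_mul msupp0 big_seq_fset0. Qed.

Lemma gr_mulr0 : right_zero 0 gr_mul.
Proof.
by move=> g; rewrite /gr_mul big1 // => k _; rewrite msupp0 big_seq_fset0.
Qed.

Lemma gr_mulUU c1 c2 k1 k2 :
  gr_mul << c1 *g k1 >> << c2 *g k2 >> = << c1 * c2 *g (k1 * k2)%g >>.
Proof. by rewrite (gr_mulw msuppU_le msuppU_le) !big_seq_fset1 !mcoeffUU. Qed.

Lemma gr_ind (P : groupRing G -> Prop) :
  P 0 -> (forall g1 g2, P g1 -> P g2 -> P (g1 + g2)) ->
  (forall c x, P << c *g x >>) -> forall g, P g.
Proof.
move=> P0 PD PU g; rewrite [g]monalgE.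
by apply: (big_ind P) => // x _; apply: PU.
Qed.

Lemma gr_mulA : associative gr_mul.
Proof.
move=> g1 g2 g3; elim/gr_ind: g1 => [|g g' IH IH'|c1 x1].
- by rewrite !gr_mul0.
- by rewrite !gr_mulDl IH IH'.
elim/gr_ind: g2 => [|g g' IH IH'|c2 x2].
- by rewrite gr_mulr0 !gr_mul0 gr_mulr0.
- by rewrite gr_mulDr !gr_mulDl gr_mulDr IH IH'.
elim/gr_ind: g3 => [|g g' IH IH'|c3 x3].
- by rewrite !gr_mulr0.
- by rewrite !gr_mulDr IH IH'.
by rewrite !gr_mulUU mulrA mulgA.
Qed.

Lemma gr_eltE x : gr_elt x = << x >>.
Proof. by rewrite gr_elt.unlock. Qed.

Lemma gr_mul1 : left_id (gr_elt 1%g) gr_mul.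
Proof.
elim/gr_ind => [|g g' IH IH'|c x]; first by rewrite gr_mulr0.
  by rewrite gr_mulDr IH IH'.
by rewrite gr_eltE gr_mulUU mul1r mul1g.
Qed.

Lemma gr_mulr1 : right_id (gr_elt 1%g) gr_mul.
Proof.
elim/gr_ind => [|g g' IH IH'|c x]; first by rewrite gr_mul0.
  by rewrite gr_mulDl IH IH'.
by rewrite gr_eltE gr_mulUU mulr1 mulg1.
Qed.

Lemma gr_elt1_neq0 : gr_elt 1%g != 0.
Proof. by rewrite gr_eltE monalgU_eq0. Qed.

HB.instance Definition _ := GRing.Zmodule_isNzRing.Build (groupRing G)
  gr_mulA gr_mul1 gr_mulr1 gr_mulDl gr_mulDr gr_elt1_neq0.

Lemma gr_eltM : {morph gr_elt : x y / (x * y)%g >-> x * y}.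
Proof. by move=> x y; rewrite !gr_eltE [RHS]gr_mulUU mulr1. Qed.

Lemma gr_elt1 : gr_elt 1%g = 1.
Proof. by []. Qed.

End GroupRing.

Section ComGroupRing.
Variable G : abGroupType.

Lemma gr_mulC : @commutative (groupRing G) _ *%R.
Proof.
move=> g1 g2; elim/gr_ind: g1 => [|g g' IH IH'|c1 x1].
- by rewrite mul0r mulr0.
- by rewrite mulrDl mulrDr IH IH'.
elim/gr_ind: g2 => [|g g' IH IH'|c2 x2].
- by rewrite mul0r mulr0.
- by rewrite mulrDl mulrDr IH IH'.
by rewrite [LHS]gr_mulUU [RHS]gr_mulUU mulrC abg_mulC.
Qed.

HB.instance Definition _ :=
  GRing.PzRing_hasCommutativeMul.Build (groupRing G) gr_mulC.

End ComGroupRing.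

Definition gr_map (G H : groupType) (f : G -> H) (a : groupRing G) :
  groupRing H := mmap (fun n : int => n%:~R%R) (fun x => gr_elt (f x)) a.

Section Fox.
Local Open Scope fset_scope.
Local Open Scope ring_scope.
Variable Y : choiceType.
Implicit Types (w : seq (letter Y)) (s : Y).

Definition fox_prefix w (k : nat) (b : bool) : freeGroup Y :=
  fg_of (take (if b then k else k.+1) w).

(* The derivative of a word that need not be reduced; [fox_word_reduce] is the
   independence of the word representing an element. *)
Definition fox_word w s : groupRing (freeGroup Y) :=
  \sum_(k < size w | (tnth (in_tuple w) k).1 == s)
    let b := (tnth (in_tuple w) k).2 in
    << (if b then 1 else -1) *g fox_prefix w k b >>.

Definition fox (u : freeGroup Y) s := fox_word u s.

Lemma fox_word_nil s : fox_word [::] s = 0.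
Proof. by rewrite /fox_word big_ord0. Qed.

Definition fox_letter (c : letter Y) s : groupRing (freeGroup Y) :=
  if c.1 == s then if c.2 then 1 else - gr_elt (fg_gen c.1)^-1%g else 0.

Lemma fox_word_cons c w s :
  fox_word (c :: w) s = fox_letter c s + gr_elt (fg_of [:: c]) * fox_word w s.
Proof.
rewrite /fox_word [LHS]big_mkcond /= big_ord_recl /= mulr_sumr -big_mkcond /=.
congr (_ + _).
  rewrite /fox_letter (tnth_nth c) /=; case: eqP => // _.
  case: c => y [] /=; last rewrite gr_eltE -monalgUN /=.
    by rewrite -(gr_elt1 (freeGroup Y)) gr_eltE; congr mkmalgU; apply: val_inj.
  by congr mkmalgU; rewrite /fox_prefix /= take0; apply: val_inj.
apply: eq_big => [k|k _]; first by rewrite !(tnth_nth c).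
rewrite !(tnth_nth c) /= gr_eltE [RHS]gr_mulUU mul1r; congr (mkmalgU _ _).
by rewrite -fg_of_cat; case: (nth c w k).2.
Qed.

Lemma fox_word_reduce w s : fox_word (reduce w) s = fox_word w s.
Proof.
elim: w => [|c w IH] //=; rewrite -/(reduce w) fox_word_cons -IH.
case: (reduce w) => [|c' w'] /=; first by rewrite fox_word_cons.
case: eqP => [->|_]; last by rewrite -fox_word_cons.
rewrite fox_word_cons mulrDr mulrA -gr_eltM -fg_of_cat addrA.
have -> : fg_of ([:: c] ++ [:: linv c]) = 1%g.
  by apply: val_inj => /=; rewrite eqxx.
rewrite gr_elt1 mul1r -[LHS]add0r; congr (_ + _).
rewrite /fox_letter /=; case: eqP => _; last by rewrite mulr0 addr0.
case: c => y [] /=; last by rewrite mulr1 addrC; apply/esym/eqP;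
  rewrite subr_eq0; apply/eqP; congr gr_elt; apply: val_inj.
rewrite mulrN -gr_eltM.
have -> : (fg_of [:: (y, true)] * (fg_gen y)^-1 = 1)%g by rewrite mulgV.
by rewrite subrr.
Qed.

Lemma fox_of w s : fox (fg_of w) s = fox_word w s.
Proof. exact: fox_word_reduce. Qed.

(* Off this finite sequence the Fox derivatives of u vanish (see [fox_out]). *)
Definition letters (u : freeGroup Y) : seq Y :=
  undup [seq c.1 | c <- fg_word u].

Lemma fox_out u s : s \notin letters u -> fox u s = 0.
Proof.
rewrite mem_undup => us; rewrite /fox /fox_word big1 // => k /eqP ks.
by case/mapP: us; exists (tnth (in_tuple u) k); rewrite ?mem_tnth.
Qed.

End Fox.

Section WX.
Local Open Scope fset_scope.
Local Open Scope ring_scope.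
Variable X : choiceType.

Local Notation ZFN := (groupRing (FN X)).

(* The polynomial ring over Z[F/N] in the commuting variables t_x, where
   t_x = [<< ucm x >>]. *)
Definition polyFN : Type := {malg ZFN[{cmonom X}]}.
HB.instance Definition _ := GRing.ComAlgebra.on polyFN.

Definition t_mon (s : freeComSemigroup X) : polyFN := << fcs_monom s >>.

Definition foxN (u : Fgroup X) (s : freeComSemigroup X) : ZFN :=
  gr_map \pi_(FN X)%qT (fox u s).

Definition fpoly (u : Fgroup X) : polyFN :=
  (1 - \sum_(s <- letters u) foxN u s)%:MP
  + \sum_(s <- letters u) foxN u s *: t_mon s.

Definition monom_val (h : X -> ZFN) (m : {cmonom X}) : ZFN :=
  \prod_(x <- finsupp m) h x ^+ m x.

Lemma monom_val_morph (h : X -> ZFN) : mmorphism (monom_val h).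
Proof.
have W (d : {fset X}) (m : {cmonom X}) : finsupp m `<=` d ->
    monom_val h m = \prod_(x <- d) h x ^+ m x.
  move=> le; rewrite /monom_val (big_fset_incl _ le) // => x _.
  by rewrite -cmE_eq0 => /eqP->; rewrite expr0.
split=> [m1 m2|]; last by rewrite /monom_val mdom1 big_seq_fset0.
rewrite (W (finsupp m1 `|` finsupp m2) (mmul m1 m2)); last by rewrite mdomD.
rewrite (W _ m1 (fsubsetUl _ (finsupp m2))) (W _ m2 (fsubsetUr (finsupp m1) _)).
rewrite -big_split /=.
by apply: eq_bigr => x _; rewrite cmM exprD.
Qed.

HB.instance Definition _ h :=
  isMultiplicative.Build {cmonom X} ZFN (monom_val h) (monom_val_morph h).

Definition ev (h : X -> ZFN) : polyFN -> ZFN := mmap idfun (monom_val h).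
HB.instance Definition _ h := GRing.LRMorphism.on (ev h).

Lemma ev_var h x : ev h << ucm x >> = h x.
Proof.
by rewrite [LHS]mmapU /= mul1r /monom_val mdomU big_seq_fset1 cmUU expr1.
Qed.

Definition ev1 := ev (fun=> 1).
Definition evX := ev (fun x => gr_elt (\pi_(FN X)%qT (fg_gen (fcs_gen x)))).


Definition in_wX (f : polyFN) : bool :=
  (ev1 f == 1) && `[< exists a : FN X, evX f = gr_elt a >].

Record wX : predArgType := WX { wX_val :> polyFN; _ : in_wX wX_val }.
HB.instance Definition _ := [isSub for wX_val].
HB.instance Definition _ := [Choice of wX by <:].

Lemma wX_ev1 (f : wX) : ev1 f = 1.
Proof. by case: f => f /= /andP[/eqP]. Qed.

Lemma wX_evX (f : wX) : exists a : FN X, evX f = gr_elt a.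
Proof. by case: f => f /= /andP[_ /asboolP]. Qed.

Let algebra_laws (e : polyFN -> ZFN) :=
  [/\ {morph e : p q / p + q}, {morph e : p / - p},
      {morph e : p q / p * q}, e 1 = 1
    & forall (c : ZFN) p, e (c *: p) = c * e p].

Let evE h : algebra_laws (ev h).
Proof.
split; [exact: rmorphD | exact: rmorphN | exact: rmorphM | exact: rmorph1 |].
by move=> c p; rewrite [LHS]linearZ.
Qed.

Let ev1E : algebra_laws ev1. Proof. exact: evE. Qed.
Let evXE : algebra_laws evX. Proof. exact: evE. Qed.

Definition wX_star (f g : polyFN) : polyFN := f + evX f *: (g - 1).

Lemma wX_star_subproof (f g : wX) : in_wX (wX_star f g).
Proof.
have [D1 N1 _ E1 Z1] := ev1E.
have [DX NX _ EX ZX] := evXE.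
rewrite /in_wX D1 Z1 D1 N1 E1 !wX_ev1 subrr mulr0 addr0 eqxx.
apply/asboolP; have [a fa] := wX_evX f; have [b gb] := wX_evX g.
exists (a * b)%g; rewrite DX ZX DX NX EX fa gb gr_eltM.
by rewrite mulrBr mulr1 addrC subrK.
Qed.

Lemma evX_star (f g : polyFN) : evX (wX_star f g) = evX f * evX g.
Proof.
have [DX NX _ EX ZX] := evXE.
by rewrite DX ZX DX NX EX mulrBr mulr1 addrC subrK.
Qed.

Definition wX_inv_val (f : wX) : polyFN :=
  1 - gr_elt (projT1 (cid (wX_evX f)))^-1%g *: (wX_val f - 1).

Lemma wX_inv_subproof (f : wX) : in_wX (wX_inv_val f).
Proof.
have [D1 N1 _ E1 Z1] := ev1E.
have [DX NX _ EX ZX] := evXE.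
rewrite /in_wX /wX_inv_val; case: (cid _) => a fa /=.
rewrite D1 N1 Z1 D1 N1 E1 wX_ev1 subrr mulr0 subr0 eqxx.
apply/asboolP; exists a^-1%g; rewrite DX NX ZX DX NX EX fa.
by rewrite mulrBr -gr_eltM mulVg mulr1 gr_elt1 opprB addrC subrK.
Qed.

Lemma wX_one_subproof : in_wX 1.
Proof.
rewrite /in_wX; have [_ _ _ -> _] := ev1E; rewrite eqxx /=.
by apply/asboolP; exists 1%g; have [_ _ _ -> _] := evXE.
Qed.

Lemma wX_circ_subproof (f g : wX) : in_wX (wX_val f * wX_val g).
Proof.
have [_ _ M1 _ _] := ev1E.
have [_ _ MX _ _] := evXE.
rewrite /in_wX M1 !wX_ev1 mulr1 eqxx.
apply/asboolP; have [a fa] := wX_evX f; have [b gb] := wX_evX g.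
by exists (a * b)%g; rewrite MX fa gb gr_eltM.
Qed.

Definition wX_mul (f g : wX) : wX := WX (wX_star_subproof f g).
Definition wX_inv (f : wX) : wX := WX (wX_inv_subproof f).
Definition wX_one : wX := WX wX_one_subproof.
Definition wX_circ (f g : wX) : wX := WX (wX_circ_subproof f g).

Lemma wX_mulA : associative wX_mul.
Proof.
move=> f g h; apply: val_inj; rewrite /= [RHS]/wX_star evX_star /wX_star.
by rewrite -[RHS]addrA -scalerA -scalerDr [in LHS]addrAC.
Qed.

Lemma wX_mul1 : left_id wX_one wX_mul.
Proof.
move=> f; apply: val_inj; rewrite /= /wX_star.
have [_ _ _ EX _] := evXE.
by rewrite EX scale1r addrC subrK.
Qed.

Lemma wX_mulr1 : right_id wX_one wX_mul.
Proof.
by move=> f; apply: val_inj; rewrite /= /wX_star subrr scaler0 addr0.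
Qed.

Lemma wX_mulV : left_inverse wX_one wX_inv wX_mul.
Proof.
move=> f; apply: val_inj; rewrite /= /wX_star.
have [DX NX _ EX ZX] := evXE.
rewrite /wX_inv_val; case: (cid _) => a fa /=.
rewrite DX NX ZX DX NX EX fa.
rewrite mulrBr -gr_eltM mulVg mulr1 gr_elt1 opprB.
rewrite [X in _ + X *: _]addrC [X in _ + X *: _]subrK.
by rewrite subrK.
Qed.

Lemma wX_mulrV : right_inverse wX_one wX_inv wX_mul.
Proof.
move=> f; apply: val_inj; rewrite /= /wX_star.
rewrite /wX_inv_val; case: (cid _) => a fa /=.
rewrite fa addrAC subrr add0r scalerN scalerA -gr_eltM mulgV gr_elt1 scale1r.
by rewrite opprB addrC subrK.
Qed.

HB.instance Definition _ := isGroup.Build wX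
  wX_mulA wX_mul1 wX_mulr1 wX_mulV wX_mulrV.

Lemma wX_circA : associative wX_circ.
Proof. by move=> f g h; apply: val_inj; rewrite /= mulrA. Qed.

Lemma wX_circC : commutative wX_circ.
Proof. by move=> f g; apply: val_inj; rewrite /= mulrC. Qed.

Lemma wX_circMr (f g h : wX) :
  wX_circ f (g * h)%g = (wX_circ f g * f^-1 * wX_circ f h)%g.
Proof.
apply: val_inj => /=; rewrite {2}/wX_star evX_star.
have [DX NX MX EX ZX] := evXE.
rewrite /wX_star /wX_inv_val; case: (cid _) => a fa /=.
have -> : evX (wX_val f * wX_val g) = gr_elt a * evX g by rewrite MX fa.
rewrite DX NX ZX DX NX EX fa.
set q := evX g; set A := gr_elt a; set B := gr_elt a^-1%g.
have AB : B * A = 1 by rewrite -gr_eltM mulVg.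
have -> : A * q * (1 - B * (A - 1)) = q.
  have -> : B * (A - 1) = 1 - B by rewrite mulrBr AB mulr1.
  by rewrite opprB [1 + _]addrC subrK mulrAC [A * B]mulrC AB mul1r.
rewrite [1 - _ - 1]addrAC subrr add0r scalerN scalerA.
rewrite mulrAC [A * B]mulrC AB mul1r -addrA; rewrite mulrDr; congr (_ + _).
rewrite -scalerAr mulrBr mulr1 -scalerN opprB -scalerDr; congr (_ *: _).
by rewrite [RHS]addrC addrA subrK.
Qed.

Lemma wX_circMl (f g h : wX) :
  wX_circ (g * h)%g f = (wX_circ g f * f^-1 * wX_circ h f)%g.
Proof. by rewrite ![wX_circ _ f]wX_circC wX_circMr. Qed.

HB.instance Definition _ := Group_isWire.Build wX
  wX_circA wX_circMr wX_circMl.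
HB.instance Definition _ := Wire_isCommutative.Build wX wX_circC.

End WX.

(* Main.v *)
Require Import Defs.
From HB Require Import structures.
From mathcomp Require Import all_boot ssralg ssrint finmap.
From mathcomp.multinomials Require Import monalg.
From mathcomp.classical Require Import boolp.

(* The map u |-> f_u is the group morphism from the free group F to (W(X), star)
   sending each y in Y to t_y; it satisfies ev_X(f_u) = [u], and elements with
   ev_X = 1 commute in W(X), so it kills N'.  Both sides of the compatibility
   with circ are affine in each argument, so generators suffice.
   For bijectivity, choose a section sigma of F/N' -> F/N and let phi be the
   additive map from Z[F/N][t] to the abelian group N/N' with
     phi(a m) = sigma(a) m sigma(a [m])^-1    (a in F/N, m a monomial).
   Geometrically N/N' is the first homology group of the Cayley graph of F/N on
   Y, and phi closes up each edge along chosen paths from the base point.  Then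
     phi(a (f_u - 1)) = sigma(a) u sigma(a [u])^-1
   since both sides are crossed homomorphisms in u, and
     f_(phi p) - 1 = p - ev_1 p + S(ev_1 p - ev_X p),
   where S is additive with S(a) = f_(sigma a) - 1, as both sides are additive
   in p.  These two identities show that
     g |-> sigma(1)^-1 phi(g - 1) sigma(ev_X g)
   is a two-sided inverse. *)

Set Implicit Arguments.
Unset Strict Implicit.
Unset Printing Implicit Defensive.

Import GRing.Theory.

Local Open Scope fset_scope.
Local Open Scope ring_scope.
Local Open Scope quotient_scope.

(** * Additive maps out of the polynomial ring over Z[F/N] *)

Section AdditiveExtension.
Variables (V : zmodType).

Section Malg.
Variables (K : choiceType) (G : zmodType) (h : K -> G -> V).
Hypothesis hB : forall k, {morph h k : x y / x - y}.

Let h0 k : h k 0 = 0.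
Proof. by rewrite -(subrr 0) hB subrr. Qed.

(** The coefficient group is arbitrary so that the construction can be nested: once over [int], once
    over Z[F/N]. *)
Definition malg_ext (g : {malg G[K]}) : V := \sum_(k <- msupp g) h k g@_k.

Lemma malg_extEw (d : {fset K}) (g : {malg G[K]}) :
  msupp g `<=` d -> malg_ext g = \sum_(k <- d) h k g@_k.
Proof.
move=> le; rewrite [LHS](big_fset_incl _ le) // => k _ /mcoeff_outdom ->.
exact: h0.
Qed.

Lemma malg_extB : {morph malg_ext : p q / p - q}.
Proof.
move=> p q; pose d := msupp p `|` msupp q.
rewrite (malg_extEw (msuppB_le p q)) (malg_extEw (fsubsetUl _ (msupp q))).
rewrite (malg_extEw (fsubsetUr (msupp p) _)) -sumrB.
by apply: eq_bigr => k _; rewrite mcoeffB hB.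
Qed.

Lemma malg_extU k c : malg_ext << c *g k >> = h k c.
Proof. by rewrite (malg_extEw msuppU_le) big_seq_fset1 mcoeffUU. Qed.

End Malg.

Variable X : choiceType.

(** The elements [<< gr_elt a *g m >>] form a Z-basis of the polynomial ring, so values on them may
    be prescribed freely. *)
Lemma polyFN_additive (h : FN X -> {cmonom X} -> V) :
  exists phi : {additive polyFN X -> V},
    forall a m, phi << gr_elt a *g m >> = h a m.
Proof.
pose h1 m (c : groupRing (FN X)) := malg_ext (fun a n => h a m *~ n) c.
have h1B m : {morph h1 m : x y / x - y}.
  by apply: malg_extB => a x y; rewrite mulrzBr.
pose phi : {additive polyFN X -> V} := HB.pack (malg_ext h1)
  (GRing.isZmodMorphism.Build (polyFN X) V _ (malg_extB h1B)).
exists phi => a m /=.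
rewrite malg_extU // gr_eltE [LHS]malg_extU // => b x y.
by rewrite mulrzBr.
Qed.

Lemma polyFN_additive_ext (phi psi : {additive polyFN X -> V}) :
  (forall a m, phi << gr_elt a *g m >> = psi << gr_elt a *g m >>) ->
  phi =1 psi.
Proof.
move=> eqU p; rewrite [p]monalgE !raddf_sum; apply: eq_bigr => m _.
elim/gr_ind: (_@_m) => [|c d IHc IHd|n a].
- by rewrite monalgU0 !raddf0.
- rewrite monalgUD (raddfD phi) (raddfD psi).
  exact: (congr2 +%R IHc IHd).
have -> : << n *g a >> = gr_elt a *~ n :> groupRing (FN X).
  by rewrite gr_eltE -raddfMz intz.
by rewrite raddfMz [LHS]raddfMz [RHS]raddfMz eqU.
Qed.

End AdditiveExtension.

(** * Monomials: their classes in F/N' and their evaluations *)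

Section Monomials.
Variable X : choiceType.
Implicit Types m : {cmonom X}.

Lemma cmonom_ind (P : {cmonom X} -> Prop) :
  P mone -> (forall x m, P m -> P (mmul (ucm x) m)) -> forall m, P m.
Proof.
move=> P1 PM m; move: {2}(mdeg m) (erefl (mdeg m)) => n.
elim: n m => [|n IH] m mn; first by rewrite (mdeg_eq0I mn).
have [x mx] : exists x, x \in finsupp m.
  by apply/fset0Pn; apply: contra_eq_neq mn; rewrite mdegE => ->;
     rewrite big_seq_fset0.
have mE : m = mmul (ucm x) (divcm m (ucm x)).
  apply/eqP/cmP => y; rewrite cmM divcmE cmU subnKC //.
  by case: eqP => // <-; rewrite lt0n cmE_neq0.
rewrite mE; apply/PM/IH; move: mn.
by rewrite {1}mE mdegM mdegU => -[].
Qed.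

(** The monomial 1 lies outside Y; it gets the neutral element, which is the unit of both operations
    of F/N'. *)
Definition monom_class m : FN' X :=
  if insub m is Some y then \pi_(FN' X) (fg_gen y) else 1%g.

Lemma monom_class_val (y : freeComSemigroup X) :
  monom_class (fcs_monom y) = \pi_(FN' X) (fg_gen y).
Proof. by rewrite /monom_class valK. Qed.

Lemma monom_class1 : monom_class mone = 1%g.
Proof. by rewrite /monom_class insubF // eqxx. Qed.

Lemma rho1 : rho (1 : FN' X)%g = 1%g.
Proof. by rewrite -[1%g]/(\pi_(FN' X) 1%g) rhoE. Qed.

Lemma rho_monom_class_mmul m1 m2 :
  rho (monom_class (mmul m1 m2)) =
  (rho (monom_class m1) * rho (monom_class m2))%g.
Proof.
have [->|m1n1] := eqVneq m1 mone.
  by rewrite mul1m monom_class1 rho1 mul1g.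
have [->|m2n1] := eqVneq m2 mone.
  by rewrite mulm1 monom_class1 rho1 mulg1.
pose y1 := FreeComSemigroup m1n1; pose y2 := FreeComSemigroup m2n1.
rewrite -[mmul m1 m2]/(fcs_monom (fcs_mul y1 y2)).
rewrite -[m1]/(fcs_monom y1) -[m2]/(fcs_monom y2) !monom_class_val !rhoE.
exact: piN_rel.
Qed.

Lemma ev1_monom m : ev1 << m >> = 1.
Proof.
rewrite [LHS]mmapU mul1r /= /monom_val big1 // => x _.
by rewrite expr1n.
Qed.

Lemma evX_monom m : evX << m >> = gr_elt (rho (monom_class m)).
Proof.
rewrite [LHS]mmapU mul1r; elim/cmonom_ind: m => [|x m IH].
  by rewrite mmorph1 monom_class1 -[1%g]/(\pi_(FN' X) 1%g) rhoE.
rewrite mmorphM /= IH rho_monom_class_mmul gr_eltM; congr (_ * _).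
have := ev_var (fun x => gr_elt (\pi_(FN X) (fg_gen (fcs_gen x)))) x.
rewrite [LHS]mmapU mul1r => ->.
by rewrite -[ucm x]/(fcs_monom (fcs_gen x)) monom_class_val rhoE.
Qed.

Lemma t_mon_subproof (y : freeComSemigroup X) : in_wX (t_mon y).
Proof.
rewrite /in_wX ev1_monom eqxx; apply/asboolP.
by exists (rho (monom_class (fcs_monom y))); rewrite evX_monom.
Qed.

End Monomials.

(** * The group morphism from F to W(X) and its descent to F/N' *)

Section FreeLift.
Variable X : choiceType.

Definition wX_of_free : Fgroup X -> wX X :=
  fg_lift (fun y => WX (t_mon_subproof y)).

Lemma wX_of_freeM : {morph wX_of_free : u v / (u * v)%g}.
Proof. exact: fg_liftM. Qed.

Lemma wX_of_free_gen y : wX_val (wX_of_free (fg_gen y)) = t_mon y.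
Proof. by rewrite /wX_of_free fg_lift_gen. Qed.

Lemma wX_val_mul (f g : wX X) :
  wX_val (f * g)%g = wX_val f + evX (wX_val f) *: (wX_val g - 1).
Proof. by []. Qed.

Lemma evX_mul (f g : wX X) :
  evX (wX_val (f * g)%g) = evX (wX_val f) * evX (wX_val g).
Proof. exact: evX_star. Qed.

Lemma evX_one : evX (wX_val (1%g : wX X)) = 1.
Proof. by rewrite [LHS]rmorph1. Qed.

Lemma evX_wX_of_free u : evX (wX_val (wX_of_free u)) = gr_elt (\pi_(FN X) u).
Proof.
elim/fg_ind: u => [|y|u v IHu IHv|u IHu].
- by rewrite (morphg1 wX_of_freeM) evX_one.
- by rewrite wX_of_free_gen evX_monom monom_class_val rhoE.
- by rewrite wX_of_freeM evX_mul IHu IHv piNM gr_eltM.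
- have := evX_mul (wX_of_free u^-1%g) (wX_of_free u).
  rewrite -wX_of_freeM mulVg (morphg1 wX_of_freeM) evX_one IHu.
  move/(congr1 (fun c => c * gr_elt (\pi_(FN X) u^-1%g))).
  by rewrite mul1r -mulrA -gr_eltM -piNM mulgV gr_elt1 mulr1.
Qed.

Lemma wX_of_free_N' (u v : Fgroup X) :
  \pi_(FN' X) u = \pi_(FN' X) v -> wX_of_free u = wX_of_free v.
Proof.
move/(@quot_eqP _ (N'sub X) _ _) => uv.
suff: wX_of_free (u^-1 * v)%g = 1%g.
  by rewrite wX_of_freeM (morphgV wX_of_freeM) => /mulg1_eq; rewrite invgK.
apply/eqP; move: (u^-1 * v)%g uv => {u v}.
apply: (subgroup_gen_sub (S := [pred u | wX_of_free u == 1%g])).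
  split=> [|u v]; rewrite !inE; first by rewrite (morphg1 wX_of_freeM).
  move=> /eqP u1 /eqP v1.
  by rewrite wX_of_freeM (morphgV wX_of_freeM) u1 v1 mulgV.
move=> _ [u [v [/(pi_eq1 (Nsub X)) Nu /(pi_eq1 (Nsub X)) Nv ->]]]; rewrite inE.
(* For u and v in N both images have ev_X = 1, where star becomes the symmetric expression f + g -
   1. *)
have uv : commute (wX_of_free u) (wX_of_free v).
  apply: val_inj; rewrite [LHS]wX_val_mul [RHS]wX_val_mul !evX_wX_of_free Nu Nv.
  rewrite gr_elt1 !scale1r. exact: addrCA.
rewrite /commg /conjg !wX_of_freeM !(morphgV wX_of_freeM).
by apply/(commgP (x := wX_of_free u) (y := wX_of_free v)).
Qed.

End FreeLift.

(** * Fox calculus: the image of u is [fpoly u] *)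

Section FoxPolynomial.
Variable X : choiceType.
Local Notation Y := (freeComSemigroup X).
Implicit Types (w : seq (letter Y)) (u : Fgroup X).
Local Notation gr_piN := (gr_map (\pi_(FN X) : Fgroup X -> FN X)).

Lemma gr_mapD (G H : groupType) (f : G -> H) :
  {morph gr_map f : a b / a + b}.
Proof. by move=> a b; rewrite /gr_map [LHS]raddfD. Qed.

Lemma gr_map0 (G H : groupType) (f : G -> H) : gr_map f 0 = 0.
Proof. by rewrite /gr_map [LHS]raddf0. Qed.

Lemma gr_mapN (G H : groupType) (f : G -> H) :
  {morph gr_map f : a / - a}.
Proof. by move=> a; rewrite /gr_map [LHS]raddfN. Qed.

Lemma gr_mapU (G H : groupType) (f : G -> H) x n :
  gr_map f << n *g x >> = gr_elt (f x) *~ n.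
Proof. by rewrite /gr_map [LHS]mmapU /= mulrzl. Qed.

Lemma gr_map_elt (G H : groupType) (f : G -> H) x :
  gr_map f (gr_elt x) = gr_elt (f x).
Proof. by rewrite gr_eltE gr_mapU. Qed.

Lemma gr_map_mul_elt (G H : groupType) (f : G -> H) x a :
  {morph f : y z / (y * z)%g} ->
  gr_map f (gr_elt x * a) = gr_elt (f x) * gr_map f a.
Proof.
move=> fM; elim/gr_ind: a => [|a b IHa IHb|n y].
- by rewrite mulr0 gr_map0 mulr0.
- by rewrite mulrDr !gr_mapD mulrDr IHa IHb.
- by rewrite [in LHS]gr_eltE [_ * _]gr_mulUU mul1r !gr_mapU fM gr_eltM mulrzAr.
Qed.

Lemma wX_of_freeV u :
  wX_val (wX_of_free u^-1%g) - 1 =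
  - (gr_elt (\pi_(FN X) u^-1%g) *: (wX_val (wX_of_free u) - 1)).
Proof.
have := wX_val_mul (wX_of_free u^-1%g) (wX_of_free u).
rewrite -wX_of_freeM mulVg (morphg1 (@wX_of_freeM X)) evX_wX_of_free.
move=> E; apply/eqP; rewrite -addr_eq0 addrAC -E; apply/eqP; exact: subrr.
Qed.

Lemma fox_letter_sum (r : seq Y) (c : letter Y) : uniq r -> c.1 \in r ->
  \sum_(s <- r) gr_piN (fox_letter c s) *: (t_mon s - 1) =
  wX_val (wX_of_free (fg_of [:: c])) - 1.
Proof.
move=> r_uniq rc; rewrite (bigD1_seq c.1) //= big1 => [|s sc]; last first.
  by rewrite /fox_letter eq_sym (negPf sc) gr_map0 scale0r.
rewrite addr0 /fox_letter eqxx; case: c rc => y [] _ /=.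
  by rewrite -gr_elt1 gr_map_elt gr_elt1 scale1r wX_of_free_gen.
have -> : fg_of [:: (y, false)] = (fg_gen y)^-1%g by [].
by rewrite wX_of_freeV gr_mapN gr_map_elt scaleNr wX_of_free_gen.
Qed.

(** This is the fundamental formula of Fox calculus: under prepending a letter, both sides obey the
    same crossed recursion. The index list [r] is independent of [w] so that it stays fixed while
    the word shrinks. *)
Lemma fox_word_sum (r : seq Y) w :
  uniq r -> {subset [seq c.1 | c <- w] <= r} ->
  \sum_(s <- r) gr_piN (fox_word w s) *: (t_mon s - 1) =
  wX_val (wX_of_free (fg_of w)) - 1.
Proof.
move=> r_uniq; elim: w => [|c w IH] sub.
  have -> : wX_of_free (fg_of [::]) = 1%g :> wX X.
    exact: (morphg1 (@wX_of_freeM X)).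
  rewrite [RHS](subrr (1 : polyFN X)).
  by apply: big1 => s _; rewrite fox_word_nil gr_map0 scale0r.
have rc : c.1 \in r by apply: sub; rewrite mem_head.
have {IH} := IH (fun s sw => sub s (mem_behead (s := map _ (c :: w)) sw)).
rewrite -cat1s fg_of_cat wX_of_freeM wX_val_mul addrAC evX_wX_of_free => <-.
rewrite -(fox_letter_sum r_uniq rc) scaler_sumr -big_split /=.
apply: eq_bigr => s _; rewrite fox_word_cons gr_mapD gr_map_mul_elt.
  by rewrite scalerDl scalerA.
exact: piNM.
Qed.

Lemma fpolyE u : fpoly u = wX_val (wX_of_free u).
Proof.
have := @fox_word_sum (letters u) u (undup_uniq _).
rewrite fg_ofK => E.
rewrite -[RHS](subrK 1) -E => [|s]; last by rewrite mem_undup.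
have malgCE (c : groupRing (FN X)) : c%:MP = c *: 1 :> polyFN X.
  by rewrite -[RHS]mul_malgC mulr1.
have BAC (V : zmodType) (a b c : V) : a - b + c = c - b + a.
  by rewrite addrAC [a + c]addrC addrAC.
rewrite /fpoly malgCE scalerBl scale1r scaler_suml.
apply: (etrans (BAC _ _ _ _)).
congr (_ + 1); rewrite -sumrB; apply: eq_bigr => s _.
by rewrite scalerBr.
Qed.

End FoxPolynomial.

(** * Compatibility with both wire operations *)

Section Morphism.
Variable X : choiceType.
Implicit Types (a b : FN' X) (u v : Fgroup X).

Definition wX_of_FN' a : wX X := wX_of_free (repr a).

Lemma wX_of_FN'E u : wX_of_FN' (\pi_(FN' X) u) = wX_of_free u.
Proof. by apply: wX_of_free_N'; rewrite reprK. Qed.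

Lemma wX_of_FN'M : {morph wX_of_FN' : a b / (a * b)%g}.
Proof.
elim/quotW=> u; elim/quotW=> v.
by rewrite -(piN'M u v) !wX_of_FN'E wX_of_freeM.
Qed.

Lemma wX_of_FN'1 : wX_of_FN' 1%g = 1%g.
Proof. by apply: (mulgI (wX_of_FN' 1%g)); rewrite -wX_of_FN'M !mulg1. Qed.

Lemma wX_of_FN'V : {morph wX_of_FN' : a / (a^-1)%g}.
Proof.
move=> a; apply: (mulgI (wX_of_FN' a)).
by rewrite -wX_of_FN'M !mulgV wX_of_FN'1.
Qed.

Lemma evX_wX_of_FN' a : evX (wX_val (wX_of_FN' a)) = gr_elt (rho a).
Proof. by elim/quotW: a => u; rewrite wX_of_FN'E rhoE evX_wX_of_free. Qed.

Lemma wX_of_FN'_monom m : wX_val (wX_of_FN' (monom_class m)) = << m >>.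
Proof.
have [->|m1] := eqVneq m mone; first by rewrite monom_class1 wX_of_FN'1.
rewrite -[m]/(fcs_monom (FreeComSemigroup m1)) monom_class_val wX_of_FN'E.
exact: wX_of_free_gen.
Qed.

(** Unlike [affine], this allows values in any group, in particular in W(X). *)
Definition affine_to (G : groupType) (f : FN' X -> G) : Prop :=
  forall a b, f (a * b)%g = (f a * (f 1)^-1 * f b)%g.

Lemma affine_to_ext (G : groupType) (f g : FN' X -> G) :
  affine_to f -> affine_to g -> f 1%g = g 1%g ->
  (forall y, f (\pi_(FN' X) (fg_gen y)) = g (\pi_(FN' X) (fg_gen y))) ->
  f =1 g.
Proof.
move=> fM gM fg1 fg.
have affV (h : FN' X -> G) a : affine_to h ->
    h (a^-1)%g = (h 1 * (h a)^-1 * h 1)%g.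
  move=> hM; have := hM a (a^-1)%g; rewrite mulgV => E.
  by rewrite [X in (_ * X)%g]E !mulgA mulgVK mulgV mul1g.
elim/quotW; elim/fg_ind => [//|//|u v IHu IHv|u IHu].
- by rewrite (piN'M u v) fM gM IHu IHv fg1.
- by rewrite (piN'V u) !affV // IHu fg1.
Qed.

Lemma wX_of_FN'_circ : {morph wX_of_FN' : a b / circ a b}.
Proof.
(* As 1 is neutral for [circ] in both wires, the distributive laws make [circ] affine in each
   argument: the inverted middle term is the value at 1. *)
have circ1W (f : wX X) : circ 1%g f = f.
  by apply: val_inj; exact: mul1r.
have circW1 (f : wX X) : circ f 1%g = f by rewrite circC circ1W.
have circ1N a : circ 1%g a = a by exact: FN'_circ1.
have circN1 a : circ a 1%g = a by rewrite circC circ1N.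
move=> a b; move: a.
apply: affine_to_ext => [a c|a c||y].
- by rewrite circMl !wX_of_FN'M wX_of_FN'V circ1N.
- by rewrite wX_of_FN'M circMl wX_of_FN'1 circ1W.
- by rewrite wX_of_FN'1 circ1W circ1N.
move: b; apply: affine_to_ext => [b c|b c||z].
- by rewrite circMr !wX_of_FN'M wX_of_FN'V circN1.
- by rewrite wX_of_FN'M circMr wX_of_FN'1 circW1.
- by rewrite wX_of_FN'1 circW1 circN1.
(* On generators the claim is that t of a product of monomials is the product of their t. *)
rewrite [circ _ _]FN'_circ_gen !wX_of_FN'E; apply: val_inj.
rewrite [RHS]/(wX_val _ * wX_val _) [LHS]wX_of_free_gen !wX_of_free_gen.
by rewrite [RHS]fgmulUU mulr1.
Qed.

End Morphism.

(** * The abelian group N/N' and its image in W(X) *)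

Section RhoKernel.
Variable X : choiceType.

(* The group N/N', written additively to receive integer multiples. *)
Record rhoKernel : predArgType := RhoKernel {
  rk_val :> FN' X;
  _ : rho rk_val == 1%g
}.

HB.instance Definition _ := [isSub for rk_val].
HB.instance Definition _ := [Choice of rhoKernel by <:].

Lemma rho_rk (x : rhoKernel) : rho (rk_val x) = 1%g.
Proof. by case: x => x /= /eqP. Qed.

Lemma rk_mul_subproof (x y : rhoKernel) : rho (rk_val x * rk_val y)%g == 1%g.
Proof. by rewrite rhoM !rho_rk mulg1. Qed.

Lemma rk_inv_subproof (x : rhoKernel) : rho (rk_val x)^-1%g == 1%g.
Proof. by rewrite rhoV rho_rk invg1. Qed.

Lemma rk_one_subproof : rho (1%g : FN' X) == 1%g.
Proof. by rewrite rho1. Qed.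

Definition rk_mul x y := RhoKernel (rk_mul_subproof x y).
Definition rk_inv x := RhoKernel (rk_inv_subproof x).
Definition rk_one := RhoKernel rk_one_subproof.

Lemma rk_mulA : associative rk_mul.
Proof. by move=> x y z; apply: val_inj; apply: mulgA. Qed.

Lemma rk_mulC : commutative rk_mul.
Proof. by move=> x y; apply: val_inj; apply: rho_ker_comm; apply: rho_rk. Qed.

Lemma rk_mul1 : left_id rk_one rk_mul.
Proof. by move=> x; apply: val_inj; apply: mul1g. Qed.

Lemma rk_mulV : left_inverse rk_one rk_inv rk_mul.
Proof. by move=> x; apply: val_inj; apply: mulVg. Qed.

HB.instance Definition _ := GRing.isZmodule.Build rhoKernel
  rk_mulA rk_mulC rk_mul1 rk_mulV.

Lemma rk_valD (x y : rhoKernel) : rk_val (x + y) = (rk_val x * rk_val y)%g.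
Proof. by []. Qed.

(** Since ev_X is 1 on the image of the kernel, subtracting 1 turns star into addition of
    polynomials. *)
Definition rk_poly (x : rhoKernel) : polyFN X := wX_val (wX_of_FN' x) - 1.

Lemma wX_of_FN'_kerM (b : FN' X) (x : rhoKernel) :
  wX_val (wX_of_FN' (rk_val x * b)%g) = rk_poly x + wX_val (wX_of_FN' b).
Proof.
rewrite wX_of_FN'M wX_val_mul evX_wX_of_FN' rho_rk gr_elt1 scale1r.
by rewrite addrA addrAC.
Qed.

Lemma rk_polyD : {morph rk_poly : x y / x + y}.
Proof. by move=> x y; rewrite {1}/rk_poly wX_of_FN'_kerM -addrA. Qed.

Lemma rk_polyB : {morph rk_poly : x y / x - y}.
Proof.
move=> x y; have := rk_polyD (x - y) y; rewrite subrK => ->.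
by rewrite addrK.
Qed.

HB.instance Definition _ :=
  GRing.isZmodMorphism.Build rhoKernel (polyFN X) rk_poly rk_polyB.

End RhoKernel.

(** * The two identities for phi and the inverse map *)

Section Inverse.
Variable X : choiceType.
Implicit Types (a : FN X) (b : FN' X) (m : {cmonom X}).

Definition rho_section a : FN' X := \pi_(FN' X) (repr a).
Local Notation sigma := rho_section.

Lemma rho_sectionK : cancel rho_section (@rho X).
Proof. by move=> a; rewrite rhoE reprK. Qed.

Lemma cell_subproof a b : rho (sigma a * b * (sigma (a * rho b))^-1)%g == 1%g.
Proof. by rewrite rhoM rhoV rho_sectionK rhoM rho_sectionK mulgV. Qed.

(** The loop that follows the chosen path to [a], then [b], then returns along the chosen path to
    the endpoint [a * rho b]. *)
Definition cell a b := RhoKernel (cell_subproof a b).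

Definition chain_map_spec (phi : {additive polyFN X -> rhoKernel X}) : Prop :=
  forall a m, phi << gr_elt a *g m >> = cell a (monom_class m).

Lemma scale_monom (c : groupRing (FN X)) m :
  c *: << m >> = << c *g m >> :> polyFN X.
Proof. by rewrite -mul_malgC [LHS]fgmulUU mulr1 mul1m. Qed.

Lemma chain_map_boundary phi a b : chain_map_spec phi ->
  phi (gr_elt a *: (wX_val (wX_of_FN' b) - 1)) = cell a b.
Proof.
move=> phiE; pose D b := wX_val (wX_of_FN' b) - 1.
have DM b1 b2 : D (b1 * b2)%g = D b1 + gr_elt (rho b1) *: D b2.
  by rewrite /D wX_of_FN'M wX_val_mul evX_wX_of_FN' addrAC.
have phiM b1 b2 a' : phi (gr_elt a' *: D (b1 * b2)%g) =
    phi (gr_elt a' *: D b1) + phi (gr_elt (a' * rho b1)%g *: D b2).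
  by rewrite DM scalerDr scalerA -gr_eltM raddfD.
have cellM b1 b2 a' :
    cell a' (b1 * b2)%g = cell a' b1 + cell (a' * rho b1)%g b2.
  by apply: val_inj; rewrite [RHS]rk_valD /= (rhoM b1 b2) !mulgA mulgVK.
have phi1 a' : phi (gr_elt a' *: D 1%g) = 0.
  by rewrite /D wX_of_FN'1 subrr scaler0 raddf0.
have cell1 a' : cell a' 1%g = 0.
  by apply: val_inj; rewrite /= rho1 !mulg1 mulgV.
(* By [phiM] and [cellM] the second factor of a product starts at [a * rho b1], so [a] has to stay
   general in the induction. *)
rewrite -/(D b); elim/quotW: b a; elim/fg_ind => [a|y a|u v IHu IHv a|u IHu a].
- by rewrite [LHS]phi1 [RHS]cell1.
- have phi_monom m :
      phi (gr_elt a *: (<< m >> : polyFN X)) = cell a (monom_class m).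
    exact: (etrans (congr1 phi (scale_monom _ _)) (phiE _ _)).
  rewrite /D wX_of_FN'E wX_of_free_gen scalerBr raddfB -monom_class_val.
  (* The summand 1 of [t_y - 1] contributes the cell of the empty monomial, which is trivial. *)
  rewrite -[RHS]subr0 -(cell1 a) -monom_class1.
  by congr (_ - _); apply: phi_monom.
- rewrite (piN'M u v) phiM cellM.
  exact: (congr2 +%R (IHu a) (IHv (a * rho (\pi_(FN' X) u))%g)).
- rewrite (piN'V u); move: (\pi_(FN' X) u) IHu => b IHb.
  (* Both crossed rules are applied to [b^-1 * b = 1], and the induction hypothesis is used at the
     base [a * rho b^-1]. *)
  have E1 := etrans (esym (phiM b^-1%g b a))
    (congr1 (fun b => phi (gr_elt a *: D b)) (mulVg b)).
  have E2 := etrans (esym (cellM b^-1%g b a)) (congr1 (cell a) (mulVg b)).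
  apply: (addIr (cell (a * rho b^-1)%g b)); apply: (etrans _ (esym E2)).
  by rewrite -{1}IHb; apply: (etrans E1); rewrite phi1 cell1.
Qed.

Lemma ev1_scale_monom a m : ev1 << gr_elt a *g m >> = gr_elt a.
Proof.
rewrite -scale_monom; apply: (etrans (linearZ _ _)).
by apply: (etrans (congr1 _ (ev1_monom m))); apply: mulr1.
Qed.

Lemma evX_scale_monom a m :
  evX << gr_elt a *g m >> = gr_elt (a * rho (monom_class m))%g.
Proof.
rewrite -scale_monom; apply: (etrans (linearZ _ _)).
by apply: (etrans (congr1 _ (evX_monom m))); rewrite gr_eltM.
Qed.

(** The cell times [sigma] of its endpoint equals [sigma a] times the class of [m]. In W(X) the
    first product is a sum, as the cell lies in the kernel, and the second adds [a (m - 1)] to the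
    image of [sigma a]. *)
Lemma cell_poly a m : rk_poly (cell a (monom_class m)) =
  << gr_elt a *g m >> - (gr_elt a)%:MP + (wX_val (wX_of_FN' (sigma a))
  - wX_val (wX_of_FN' (sigma (a * rho (monom_class m))%g))).
Proof.
set b := (sigma (a * rho (monom_class m)))%g.
have := wX_of_FN'_kerM b (cell a (monom_class m)).
rewrite /= mulgVK wX_of_FN'M wX_val_mul evX_wX_of_FN' rho_sectionK.
have Ez : gr_elt a *: ((<< m >> : polyFN X) - 1) =
    << gr_elt a *g m >> - (gr_elt a)%:MP.
  by apply: (etrans (scalerBr _ _ _)); congr (_ - _); exact: scale_monom.
rewrite wX_of_FN'_monom Ez => /eqP; rewrite -subr_eq => /eqP <-.
by rewrite [X in X - _]addrC addrA.
Qed.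

(** By additivity it suffices to take [p] to be [a] times a monomial; then ev_1 and ev_X give the
    two endpoints of the cell and [cell_poly] applies. *)
Lemma chain_map_poly phi (S : {additive polyFN X -> polyFN X}) p :
  chain_map_spec phi ->
  (forall a m, S << gr_elt a *g m >> = wX_val (wX_of_FN' (sigma a)) - 1) ->
  rk_poly (phi p) = p - (ev1 p)%:MP + S (ev1 p - evX p)%:MP.
Proof.
move=> phiE SE.
have BB (V : zmodType) (x y z t : V) : x - y - (z - t) = x - z - (y - t).
  by rewrite !opprB addrACA [RHS]addrACA [- y - z]addrC.
(* Here [x], [y] stand for the values of ev_1 at [q], [r], and [z], [t] for those of ev_X. *)
have affineB (U V : zmodType) (M : {additive U -> V}) (T : {additive V -> V})
    q r x y z t :
    q - r - M (x - y) + T (M (x - y - (z - t))) =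
    q - M x + T (M (x - z)) - (r - M y + T (M (y - t))).
  have -> : M (x - y - (z - t)) = M (x - z) - M (y - t) by rewrite BB raddfB.
  have -> : q - r - M (x - y) = q - M x - (r - M y) by rewrite raddfB BB.
  by rewrite (raddfB T) [in RHS]opprD addrACA.
pose lhs : {additive polyFN X -> polyFN X} := @rk_poly X \o phi.
pose rhsf q : polyFN X := q - (ev1 q)%:MP + S (ev1 q - evX q)%:MP.
have rhsB : {morph rhsf : q r / q - r}.
  move=> q r; rewrite /rhsf.
  have -> : ev1 (q - r) = ev1 q - ev1 r by rewrite [LHS]rmorphB.
  have -> : evX (q - r) = evX q - evX r by rewrite [LHS]rmorphB.
  exact: (affineB _ _ malgC S).
pose rhs : {additive polyFN X -> polyFN X} := HB.pack rhsf
  (GRing.isZmodMorphism.Build (polyFN X) (polyFN X) _ rhsB).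
apply: (polyFN_additive_ext (phi := lhs) (psi := rhs)) => a m.
rewrite /= phiE cell_poly /rhsf ev1_scale_monom evX_scale_monom.
congr (_ + _); apply/esym.
apply: (etrans (congr1 S (raddfB malgC _ _))); apply: (etrans (raddfB S _ _)).
apply: (etrans (congr2 (fun x y => x - y) (SE a mone) (SE _ mone))).
by rewrite opprB addrA subrK.
Qed.

Lemma gr_elt_inj (G : groupType) : injective (@gr_elt G).
Proof.
move=> x y /(congr1 (mcoeff x)); rewrite !gr_eltE mcoeffUU mcoeffU.
by case: eqP.
Qed.

Lemma wX_of_FN'_bij : bijective (@wX_of_FN' X).
Proof.
have [phi phiE] := polyFN_additive (fun a m => cell a (monom_class m)).
(* A map on Z[F/N] is wanted; it is extended to polynomials by ignoring the monomial, and evaluated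
   at constants. *)
have [S SE] := polyFN_additive
  (fun a (_ : {cmonom X}) => wX_val (wX_of_FN' (sigma a)) - 1 : polyFN X).
pose aug (f : wX X) : FN X := projT1 (cid (wX_evX f)).
have augE (f : wX X) : evX (wX_val f) = gr_elt (aug f).
  by rewrite /aug; case: cid.
(* The factor [(sigma 1)^-1] corrects for the chosen lift of 1, which may be nontrivial. *)
pose inv (f : wX X) : FN' X :=
  ((sigma 1)^-1 * (rk_val (phi (wX_val f - 1)) * sigma (aug f)))%g.
exists inv => [b|f].
  rewrite /inv; have -> : aug (wX_of_FN' b) = rho b.
    by apply: gr_elt_inj; rewrite -augE evX_wX_of_FN'.
  have := chain_map_boundary 1%g b phiE.
  rewrite gr_elt1 scale1r => ->.
  by rewrite /= mul1g mulgVK mulKg.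
(* Cancelling [(sigma 1)^-1] leaves a kernel element times [sigma (aug f)], whose image is a sum. As
   ev_1 vanishes at [f - 1], the terms at [sigma (aug f)] cancel, leaving [f - 1] plus the image of
   [sigma 1]. *)
apply: (mulgI (wX_of_FN' (sigma 1%g))); rewrite -wX_of_FN'M mulVKg.
apply: val_inj; rewrite [LHS]wX_of_FN'_kerM (chain_map_poly _ phiE SE).
rewrite [RHS]wX_val_mul evX_wX_of_FN' rho_sectionK gr_elt1 scale1r.
have -> : ev1 (wX_val f - 1) = 0.
  have -> : ev1 (wX_val f - 1) = ev1 (wX_val f) - ev1 1 by rewrite [LHS]rmorphB.
  by rewrite wX_ev1 -(wX_ev1 1%g) subrr.
have -> : evX (wX_val f - 1) = gr_elt (aug f) - gr_elt 1%g.
  have -> : evX (wX_val f - 1) = evX (wX_val f) - evX 1 by rewrite [LHS]rmorphB.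
  by rewrite augE gr_elt1 -(evX_one X).
rewrite raddf0 subr0 sub0r opprB.
have -> : S (gr_elt 1%g - gr_elt (aug f))%:MP =
    wX_val (wX_of_FN' (sigma 1%g)) - wX_val (wX_of_FN' (sigma (aug f))).
  apply: (etrans (congr1 S (raddfB malgC _ _))).
  apply: (etrans (raddfB S _ _)).
  apply: (etrans (congr2 (fun x y => x - y) (SE _ mone) (SE _ mone))).
  by rewrite opprB addrA subrK.
by rewrite -addrA subrK addrC.
Qed.

End Inverse.

Theorem theorem4p21 (X : choiceType) :
  exists d : FN' X -> wX X,
    [/\ forall u : Fgroup X, wX_val (d (\pi_(FN' X)%qT u)) = fpoly u,
        wire_morphism d
      & bijective d].
Proof.
exists (@wX_of_FN' X); split; last exact: wX_of_FN'_bij.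
- by move=> u; rewrite wX_of_FN'E fpolyE.
- by split; [exact: wX_of_FN'M | exact: wX_of_FN'_circ].
Qed.
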